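(* Let $S$ be the set containing 4 copies of each positive integer congruent to $\pm 1$ modulo 6 and 8 copies of each positive integer congruent to $\pm 2$ modulo 6; let $T$ be the set containing 8 copies of each positive integer congruent to $\pm 1$ modulo 6 and 4 copies of each positive integer congruent to $\pm 2$ modulo 6. Let $D_S(N)$ (respectively, $D_T(N)$) be the number of partitions of $N$ into an odd number of distinct elements of $S$ (respectively, $T$). Then, for every integer $N\geq 2$, $$D_S(N)=D_T(N-1).$$
   Context: A ''set containing several copies'' of certain integers means a set of colored integers: the different copies of the same integer are regarded as distinct (distinguishable) elements, each having that integer as its value. A partition of $N$ into distinct elements of $X$ is a finite subset of $X$ whose elements have values summing to $N$ (so each copy is used at most once, but different copies of the same integer may be used together, and subsets using different copies are counted as different); the number of parts is the cardinality of this subset. *)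

(* Defs.v *)
From mathcomp Require Import all_boot finmap.

Set Implicit Arguments.
Unset Strict Implicit.
Unset Printing Implicit Defensive.

Local Open Scope fset_scope.

(* A colored integer is a pair (value, color): the copies of n are
   (n, 0), ..., (n, k n - 1), where k n is the number of copies of n. *)
Definition colored : Type := (nat * nat)%type.

Definition copies (k : nat -> nat) : {pred colored} :=
  [pred x : colored | (0 < x.1) && (x.2 < k x.1)].

Definition is_partition (k : nat -> nat) (N : nat) (A : {fset colored}) : Prop :=
  {subset A <= copies k} /\ \sum_(x <- A) x.1 = N.

Definition copies_le (k : nat -> nat) (N : nat) : {fset colored} :=
  [fset x in [seq (n, c) | n <- iota 1 N, c <- iota 0 (k n)]].

(* Values are positive, so a partition of N only uses elements of value at
   most N; odd_partitionsP shows that no partition is lost by the bound. *)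
Definition odd_partitions (k : nat -> nat) (N : nat) : {fset {fset colored}} :=
  [fset A in fpowerset (copies_le k N)
     | (\sum_(x <- A) x.1 == N) && odd #|` A|].

Lemma mem_copies_le k N (x : colored) :
  (x \in copies_le k N) = (x \in copies k) && (x.1 <= N).
Proof.
rewrite /copies_le inE /=; case: x => n c; rewrite inE /=.
apply/allpairsPdep/idP => [[m [d [+ + [-> ->]]]]|].
  by rewrite !mem_iota /= add0n add1n ltnS => /andP[-> ->] ->.
case/andP=> /andP[n0 ck] nN; exists n, c.
by rewrite !mem_iota /= add0n add1n ltnS n0 nN ck.
Qed.

Lemma odd_partitionsP k N (A : {fset colored}) :
  reflect (is_partition k N A /\ odd #|` A|) (A \in odd_partitions k N).
Proof.
rewrite /odd_partitions !inE /= fpowersetE.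
apply: (iffP and3P) => [[/fsubsetP sA /eqP sumA oddA]|[[sA sumA] oddA]].
  by do 2!split=> //; move=> x /sA; rewrite mem_copies_le => /andP[].
split=> //; last by apply/eqP.
apply/fsubsetP => x xA; rewrite mem_copies_le sA //=.
by rewrite -sumA (big_rem x) //= leq_addr.
Qed.

Definition D (k : nat -> nat) (N : nat) : nat := #|` odd_partitions k N|.

(* 5 = -1 and 4 = -2 modulo 6. *)
Definition pm1_mod6 (n : nat) : bool := (n == 1 %[mod 6]) || (n == 5 %[mod 6]).
Definition pm2_mod6 (n : nat) : bool := (n == 2 %[mod 6]) || (n == 4 %[mod 6]).

Definition S_copies (n : nat) : nat :=
  if pm1_mod6 n then 4 else if pm2_mod6 n then 8 else 0.

Definition T_copies (n : nat) : nat :=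
  if pm1_mod6 n then 8 else if pm2_mod6 n then 4 else 0.

(* Main.v *)
Require Import Defs.
From mathcomp Require Import all_boot finmap.
From mathcomp Require Import all_algebra zify ring qpoly.

(** Write [A e], [B e], [C e] for the products of the factors 1 + e q^n over the
    positive n congruent to +-1, to +-2 and to 3 modulo 6, with e = 1 or -1.
    Keeping only the subsets of odd cardinality amounts to subtracting the
    generating function for e = -1 from the one for e = 1, which doubles the
    count.  So the theorem is the identity of power series

      A(1)^4 B(1)^8 - A(-1)^4 B(-1)^8 - q (A(1)^8 B(1)^4 - A(-1)^8 B(-1)^4) = 8 q,

    the right-hand side being why N = 1 is excluded.

    The left-hand side is G(1) - G(-1) with
    G(e) = (A(e) B(e))^4 (B(e)^4 - q A(e)^4).  Two facts finish the proof:

      B(e)^4 - q A(e)^4 = A(-1) C(-1)^6, for both signs e;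
      (A(1) B(1))^4 - (A(-1) B(-1))^4 = 8 q z^6 A(1) B(1) C(1)^6,

    with z the product of the 1 + q^(6n).  The product of the two right-hand
    sides is 8 q times (A(1) A(-1) B(1)) (C(1) C(-1) z)^6, and both parentheses
    are 1, as in Euler's theorem on odd and distinct parts.

    Both facts come from theta series.  Let f(u, v) be the sum over all integers
    k of u^(k(k+1)/2) v^(k(k-1)/2).  By Jacobi's triple product
    ([jacobi_triple_product]), E A(e), E B(e) and E C(e)^2 are values of f, where
    E is the product of the 1 - q^(6n).  The product of two values of f can be
    split according to the parity of the sum of the two summation indices
    ([theta_mul]); this gives, with P = f(q^4, q^8), Q = f(q^2, q^10),
    a = f(q^6, q^6) and b = f(1, q^12),

      E^2 A(e)^2 = Q a + e q P b,        E^2 B(e)^2 = P a + e q^2 Q b,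
      E^2 A(e) C(e)^2 = P^2 + e q Q^2,   E^2 C(e)^4 = a^2 + e q^3 b^2.

    The first fact is then the polynomial identity
    (P a + e q^2 Q b)^2 - q (Q a + e q P b)^2 = (P^2 - q Q^2) (a^2 - q^3 b^2),
    valid for e^2 = 1; the second is a similar one, combined with the product
    expansions of P Q and a b.

    Convergence is avoided by computing in a commutative ring in which q is
    nilpotent: all the sums and products become finite, and they do not depend on
    where they are cut, as soon as the cut is far enough.  The quotient of the
    integer polynomials by X^(N+1) is such a ring, and it still sees the
    coefficients of degree at most N. *)

Set Implicit Arguments.
Unset Strict Implicit.
Unset Printing Implicit Defensive.

Import GRing.Theory.
Local Open Scope ring_scope.

(** * Theta series over a ring with nilpotents *)

(** The form in which cuts are shown to be irrelevant: two index lists give the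
    same result when they differ only where the summand is neutral. *)
Lemma eq_big_support (T : Type) (idx : T) (op : Monoid.com_law idx)
    (I : eqType) (r s : seq I) (G : I -> T) :
  uniq r -> uniq s -> (forall x, (x \in r) = (x \in s) \/ G x = idx) ->
  \big[op/idx]_(x <- r) G x = \big[op/idx]_(x <- s) G x.
Proof.
move=> ur us rs.
have drop_off (u v : seq I) : (forall x, (x \in u) = (x \in v) \/ G x = idx) ->
  \big[op/idx]_(x <- u) G x = \big[op/idx]_(x <- [seq x <- u | x \in v]) G x.
  move=> uv; rewrite big_filter [LHS](bigID (mem v)) /=.
  rewrite [X in op _ X]big1_seq ?Monoid.mulm1 // => x /andP[xv xu].
  by case: (uv x) => // e; rewrite -e xu in xv.
rewrite (drop_off r s) // [RHS](drop_off s r); last first.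
  by move=> x; case: (rs x) => ->; [left | right].
apply: perm_big; apply: uniq_perm; rewrite ?filter_uniq // => x.
by rewrite !mem_filter andbC.
Qed.

(** The triangular number k(k+1)/2, for k of either sign, as an exponent. *)
Definition tri (k : int) : nat := `|(k * (k + 1) %/ 2)%Z|%N.

Lemma triE (k : int) : (tri k)%:Z * 2 = k * (k + 1).
Proof.
have h2 : (2 %| k * (k + 1))%Z.
  have [m [->|->]] : exists m : int, k = 2 * m \/ k = 2 * m + 1.
    by exists (k %/ 2)%Z; lia.
  - by apply/dvdzP; exists (m * (2 * m + 1)); ring.
  - by apply/dvdzP; exists ((2 * m + 1) * (m + 1)); ring.
have k0 : 0 <= k * (k + 1) by nia.
rewrite /tri gez0_abs ?divzK //; lia.
Qed.

Lemma tri_ge (M : nat) (k : int) : (M.+2 <= `|k|)%N -> (M <= tri k)%N.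
Proof. by move=> hk; have := triE k; nia. Qed.

(** The two changes of indices (m, n) = (i + j, i - j) and
    (m, n) = (1 - i - j, j - i) reach the pairs with m + n even and odd
    respectively; these lemmas compute the exponents met in [theta_mul]. *)
Lemma tri_even (i j : int) (m := i + j) (n := i - j) :
  [/\ tri m + tri (- m) + tri n + tri (- n) = 2 * (tri i + tri (- i) + tri j + tri (- j)),
      tri (- m) + tri (- n) = 2 * tri (- i) + tri j + tri (- j)
    & tri (- m) + tri n = tri i + tri (- i) + 2 * tri (- j)]%N.
Proof.
have := (triE i, triE (- i), triE j, triE (- j), triE m, triE (- m), triE n, triE (- n)).
by rewrite /m /n => -[[[[[[[e1 e2] e3] e4] e5] e6] e7] e8]; split; lia.
Qed.

Lemma tri_odd (i j : int) (m := 1 - i - j) (n := j - i) :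
  [/\ tri m + tri (- m) + tri n + tri (- n) = 1 + 4 * (tri (- i) + tri (- j)),
      tri (- m) + tri (- n) = tri i + tri (- i) + 2 * tri (- j)
    & tri (- m) + tri n = 2 * tri (- i) + tri j + tri (- j)]%N.
Proof.
have := (triE i, triE (- i), triE j, triE (- j), triE m, triE (- m), triE n, triE (- n)).
by rewrite /m /n => -[[[[[[[e1 e2] e3] e4] e5] e6] e7] e8]; split; lia.
Qed.

Definition box (K : nat) : seq int := [seq i%:Z - K%:Z | i <- iota 0 (2 * K).+1].

Lemma mem_box K (k : int) : (k \in box K) = (`|k| <= K)%N.
Proof.
apply/mapP/idP => [[i]|hk]; first by rewrite mem_iota; lia.
by exists (absz (k + K%:Z)); [rewrite mem_iota|]; lia.
Qed.

Lemma box_uniq K : uniq (box K).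
Proof. by rewrite map_inj_uniq ?iota_uniq // => i j; lia. Qed.

Section Theta.
Variables (R : comNzRingType).
Implicit Types (a x y u v w : R) (k : int).

Definition theta_term u v k : R := u ^+ tri k * v ^+ tri (- k).

(** Ramanujan's f(u, v), cut to the indices of absolute value at most [K]. *)
Definition theta (K : nat) u v : R := \sum_(k <- box K) theta_term u v k.

Lemma expr_nil (M n : nat) w : w ^+ M = 0 -> (M <= n)%N -> w ^+ n = 0.
Proof. by move=> w0 Mn; rewrite -(subnK Mn) exprD w0 mulr0. Qed.

(** The (m, n) term of the left-hand side is a^(m^2+n^2) times a monomial in x and
    y.  Splitting the pairs by the parity of m + n turns each half into a product
    of two series again.  This is Ramanujan's formula for f(a, b) f(c, d) with
    ab = cd, where c = ay and d = ax make both sides free of quotients. *)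
Lemma theta_mul (K M : nat) a x y :
  a ^+ M = 0 -> (M.+2 <= K)%N ->
  theta K a (a * x * y) * theta K (a * y) (a * x) =
    theta K (a * a * y) (a * a * x * x * y) * theta K (a * a * x) (a * a * x * y * y)
    + a * (theta K x (a * a * a * a * x * y * y) * theta K y (a * a * a * a * x * x * y)).
Proof.
move=> aM KM.
set pairs := [seq (m, n) | m <- box K, n <- box K].
have pairs_uniq : uniq pairs.
  by apply: allpairs_uniq; rewrite ?box_uniq // => -[? ?] [? ?].
have mem_pairs m n : ((m, n) \in pairs) = (`|m| <= K)%N && (`|n| <= K)%N.
  rewrite -!mem_box; apply/allpairsP/andP => [[[m' n'] /= [? ? [-> ->]]] //|[? ?]].
  by exists (m, n).
have prodE u v u' v' : theta K u v * theta K u' v' =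
    \sum_(p <- pairs) theta_term u v p.1 * theta_term u' v' p.2.
  rewrite /theta big_allpairs big_distrl /=.
  by apply: eq_bigr => m _; rewrite big_distrr.
pose mon (i j k : nat) := a ^+ i * x ^+ j * y ^+ k.
pose G (p : int * int) := mon (tri p.1 + tri (- p.1) + tri p.2 + tri (- p.2))%N
   (tri (- p.1) + tri (- p.2))%N (tri (- p.1) + tri p.2)%N.
(* h0 parametrizes the pairs of even sum, h1 those of odd sum. *)
pose h0 (p : int * int) : int * int := (p.1 + p.2, p.1 - p.2).
pose h1 (p : int * int) : int * int := (1 - p.1 - p.2, p.2 - p.1).
rewrite !prodE big_distrr /=.
have -> : \sum_(p <- pairs) theta_term a (a * x * y) p.1 * theta_term (a * y) (a * x) p.2
   = \sum_(p <- pairs) G p.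
  by apply: eq_bigr => p _; rewrite /theta_term /G /mon !exprMn !exprD; ring.
have -> : \sum_(p <- pairs) theta_term (a * a * y) (a * a * x * x * y) p.1 *
    theta_term (a * a * x) (a * a * x * y * y) p.2 = \sum_(p <- pairs) G (h0 p).
  apply: eq_bigr => -[i j] _; rewrite /G /=.
  transitivity (mon (2 * (tri i + tri (- i) + tri j + tri (- j)))%N
     (2 * tri (- i) + tri j + tri (- j))%N (tri i + tri (- i) + 2 * tri (- j))%N).
    by rewrite /theta_term /mon !exprMn !mul2n -!addnn !exprD; ring.
  by have [-> -> ->] := tri_even i j.
have -> : \sum_(p <- pairs) a * (theta_term x (a * a * a * a * x * y * y) p.1 *
    theta_term y (a * a * a * a * x * x * y) p.2) = \sum_(p <- pairs) G (h1 p).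
  apply: eq_bigr => -[i j] _; rewrite /G /=.
  transitivity (mon (1 + 4 * (tri (- i) + tri (- j)))%N
     (tri i + tri (- i) + 2 * tri (- j))%N (2 * tri (- i) + tri j + tri (- j))%N).
    rewrite /theta_term /mon !exprMn !(mulnDr 4) -!(mulnA 2 2) !mul2n -!addnn !exprD; ring.
  by have [-> -> ->] := tri_odd i j.
(* All nonzero terms have small indices, and these occur on both sides. *)
rewrite -(big_map h0 xpredT G) -(big_map h1 xpredT G) -big_cat {prodE}.
apply: eq_big_support; first exact: pairs_uniq.
  rewrite cat_uniq !map_inj_uniq ?pairs_uniq ?andbT.
  - apply/hasPn => p /mapP[[i j] _ ->]; apply/mapP => -[[i' j'] _ []] /=.
    by lia.
  - by move=> [i j] [i' j'] []; rewrite /=; move=> ? ?; congr pair; lia.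
  - by move=> [i j] [i' j'] []; rewrite /=; move=> ? ?; congr pair; lia.
case=> m n; rewrite mem_pairs mem_cat.
have [/andP[hm hn]|out] := boolP ((`|m| < M)%N && (`|n| < M)%N).
  left; have -> : (`|m| <= K)%N && (`|n| <= K)%N by lia.
  symmetry; apply/orP.
  have [e|o] := boolP (2 %| m + n)%Z.
    left; apply/mapP; exists (((m + n) %/ 2)%Z, ((m - n) %/ 2)%Z).
      by rewrite mem_pairs; lia.
    by rewrite /h0 /=; congr pair; lia.
  right; apply/mapP; exists (((1 - m - n) %/ 2)%Z, ((1 - m + n) %/ 2)%Z).
    by rewrite mem_pairs; lia.
  by rewrite /h1 /=; congr pair; lia.
right; rewrite /G /mon (expr_nil aM) ?mul0r //=.
by have := (triE m, triE (- m), triE n, triE (- n)) => -[[[e1 e2] e3] e4]; nia.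
Qed.

(** * Jacobi's triple product *)

(** Gaussian binomial coefficients, by the Pascal rule whose weight w^(n-j) is the
    one that [qbinom_step] produces. *)
Fixpoint qbinom w (n j : nat) : R :=
  match n, j with
  | _, 0 => 1
  | 0, _.+1 => 0
  | n'.+1, j'.+1 => qbinom w n' j + w ^+ (n' - j') * qbinom w n' j'
  end.

Lemma qbinom0 w n : qbinom w n 0 = 1. Proof. by case: n. Qed.

Lemma qbinom_small w n j : (n < j)%N -> qbinom w n j = 0.
Proof.
elim: n j => [|n IH] [|j] //= nj; rewrite !IH ?mulr0 ?addr0 //; lia.
Qed.

(** Multiplying the k-th theta term by u w^m gives w^(m-k) times the next term,
    so that comparing coefficients is exactly the Pascal rule. *)
Lemma qbinom_step u v w (m n : nat) : u * v = w ->
  (\sum_(j < (m + n).+1) qbinom w (m + n) j * theta_term u v (j%:Z - n%:Z))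
    * (1 + u * w ^+ m) =
  \sum_(j < (m + n).+2) qbinom w (m + n).+1 j * theta_term u v (j%:Z - n%:Z).
Proof.
move=> uvw.
rewrite mulrDr mulr1 [in RHS]big_ord_recl qbinom0 mul1r.
under [in RHS]eq_bigr do rewrite /= mulrDl.
rewrite big_split /= addrA; congr (_ + _).
  rewrite [in LHS]big_ord_recl qbinom0 mul1r; congr (_ + _).
  rewrite [RHS]big_ord_recr /= qbinom_small ?ltnSn // mul0r addr0.
  by [].
rewrite big_distrl; apply: eq_bigr => j _ /=.
have jmn : (j <= m + n)%N by have := ltn_ord j; lia.
have -> : (bump 0 j)%:Z - n%:Z = (j%:Z - n%:Z) + 1 by rewrite /bump /=; lia.
have km : j%:Z - n%:Z <= m%:Z by lia.
have -> : (m + n - j)%N = absz (m%:Z - (j%:Z - n%:Z))%R by lia.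
move: (j%:Z - n%:Z) km => k km.
suff key : theta_term u v k * (u * w ^+ m) = w ^+ absz (m%:Z - k)%R * theta_term u v (k + 1).
  by rewrite -mulrA key; ring.
rewrite /theta_term -uvw !exprMn.
have := (triE k, triE (- k), triE (k + 1), triE (- (k + 1))) => -[[[e1 e2] e3] e4].
transitivity (u ^+ (tri k + 1 + m) * v ^+ (tri (- k) + m)).
  by rewrite !exprD expr1; ring.
transitivity (u ^+ (absz (m%:Z - k)%R + tri (k + 1)) * v ^+ (absz (m%:Z - k)%R + tri (- (k + 1)))).
  by congr (u ^+ _ * v ^+ _); lia.
by rewrite !exprD; ring.
Qed.

(** The q-Pochhammer symbol (w; w)_n. *)
Definition poch w (n : nat) : R := \prod_(i < n) (1 - w ^+ i.+1).

Lemma pochS w n : poch w n.+1 = poch w n * (1 - w ^+ n.+1).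
Proof. by rewrite /poch big_ord_recr. Qed.

Lemma qbinomnn w n : qbinom w n n = 1.
Proof.
by elim: n => //= n ->; rewrite qbinom_small // add0r subnn expr0 mul1r.
Qed.

Lemma qbinom_poch w (a b : nat) :
  qbinom w (a + b) a * poch w a * poch w b = poch w (a + b).
Proof.
have [n] := ubnP (a + b); elim: n a b => // n IH a b abn.
case: a => [|a] in abn *; first by rewrite qbinom0 mul1r /poch big_ord0 mul1r.
case: b => [|b] in abn *.
  by rewrite addn0 qbinomnn mul1r [X in _ * X]/poch big_ord0 mulr1.
have IH1 := IH a b.+1; have IH2 := IH a.+1 b.
rewrite addSn /= addnS; have -> : ((a + b).+1 - a = b.+1)%N by lia.
rewrite addnS in IH1; rewrite addSn in IH2.
have {}IH1 := IH1 ltac:(lia); have {}IH2 := IH2 ltac:(lia).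
transitivity (qbinom w (a + b).+1 a.+1 * poch w a.+1 * poch w b * (1 - w ^+ b.+1) +
  w ^+ b.+1 * (1 - w ^+ a.+1) * (qbinom w (a + b).+1 a * poch w a * poch w b.+1)).
  by rewrite !pochS; ring.
have e : ((a + b).+2 = a.+1 + b.+1)%N by lia.
by rewrite IH1 IH2 [in RHS]pochS e exprD; ring.
Qed.

(** The geometric series inverts 1 - x. *)
Lemma lreg_sub1 (M : nat) x : x ^+ M = 0 -> GRing.lreg (1 - x).
Proof.
move=> x0 y z /= e.
have inv : (\sum_(i < M) x ^+ i) * (1 - x) = 1.
  by rewrite mulrC -opprB mulNr -subrX1 x0 sub0r opprK.
by rewrite -[y]mul1r -[z]mul1r -inv -!mulrA e.
Qed.

Lemma lreg_prod (I : Type) (r : seq I) (P : pred I) (G : I -> R) :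
  (forall i, P i -> GRing.lreg (G i)) -> GRing.lreg (\prod_(i <- r | P i) G i).
Proof.
by move=> regG; apply: big_ind => //; [exact: lreg1 | exact: lregM].
Qed.

Section Nilpotent.
Variables (M : nat) (w : R) (w0 : w ^+ M = 0).

Lemma poch_lreg n : GRing.lreg (poch w n).
Proof.
apply: lreg_prod => i _; apply: (@lreg_sub1 M).
by rewrite -exprM mulnC exprM w0 expr0n.
Qed.

Lemma big_nilp (L : nat) (G : nat -> R) :
  (M <= L)%N -> (forall i, (M <= i)%N -> G i = 1) -> \prod_(i < L) G i = \prod_(i < M) G i.
Proof.
move=> ML G1; rewrite -(subnKC ML) big_split_ord /= [X in _ * X]big1 ?mulr1 // => i _.
by rewrite G1 // leq_addr.
Qed.

Lemma poch_stationary n : (M <= n)%N -> poch w n = poch w M.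
Proof.
move=> Mn; apply: (big_nilp (G := fun i => 1 - w ^+ i.+1)) => // i Mi.
by rewrite (expr_nil w0) ?subr0 //; lia.
Qed.

(** Far from the border, every Gaussian binomial is the inverse of the infinite
    product: this is how the finite triple product passes to the limit. *)
Lemma qbinom_stationary n j : (M <= j)%N -> (j + M <= n)%N -> qbinom w n j * poch w M = 1.
Proof.
move=> Mj jMn; have := qbinom_poch w j (n - j); rewrite subnKC; last by lia.
rewrite !poch_stationary; [|lia..] => e.
by apply: (@poch_lreg M); rewrite mulr1 mulrC.
Qed.
End Nilpotent.

Lemma theta_term_swap u v k : theta_term v u k = theta_term u v (- k).
Proof. by rewrite /theta_term opprK mulrC. Qed.

(** Both sides times (w; w)_j (w; w)_(n-j) are (w; w)_n. *)
Lemma qbinom_sym (M : nat) w n j : w ^+ M = 0 -> (j <= n)%N -> qbinom w n (n - j) = qbinom w n j.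
Proof.
move=> w0 jn; apply: (poch_lreg w0 (n := j)); apply: (poch_lreg w0 (n := n - j)%N).
have e1 := qbinom_poch w j (n - j); have e2 := qbinom_poch w (n - j) j.
rewrite subnKC // in e1; rewrite subnK // in e2.
by transitivity (poch w n); [rewrite -e2 | rewrite -e1]; ring.
Qed.

(** The factors 1 + u w^i are added one by one by [qbinom_step].  For m = 0 the
    formula is the case n = 0 for the exchanged arguments, read backwards. *)
Lemma finite_triple_product (M m n : nat) u v (w := u * v) : w ^+ M = 0 ->
  \prod_(i < m) (1 + u * w ^+ i) * \prod_(i < n) (1 + v * w ^+ i) =
  \sum_(j < (m + n).+1) qbinom w (m + n) j * theta_term u v (j%:Z - n%:Z).
Proof.
move=> w0; elim: m => [|m IH]; last first.
  by rewrite big_ord_recr /= mulrAC IH (qbinom_step _ _ (erefl w)).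
rewrite big_ord0 mul1r add0n.
have -> : \prod_(i < n) (1 + v * w ^+ i) =
    \sum_(j < n.+1) qbinom w n j * theta_term v u (j%:Z - 0%N%:Z).
  elim: n => [|n IH].
    by rewrite big_ord0 big_ord1 /= mul1r /theta_term /= !expr0 mulr1.
  have := qbinom_step n 0 (mulrC v u : v * u = w); rewrite addn0 -IH => e.
  by rewrite big_ord_recr.
rewrite (reindex_inj rev_ord_inj); apply: eq_bigr => j _ /=.
have jn : (j <= n)%N by have := ltn_ord j; lia.
by rewrite subSS (qbinom_sym w0 jn) theta_term_swap; congr (_ * theta_term _ _ _); lia.
Qed.

(** Both exponents are at least [M], so (uv)^M can be factored out. *)
Lemma theta_term0 (M : nat) u v k :
  (u * v) ^+ M = 0 -> (M.+2 <= absz k)%N -> theta_term u v k = 0.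
Proof.
move=> uv0 Mk; rewrite /theta_term.
have Mt : (M <= tri k)%N by exact: tri_ge.
have Mt' : (M <= tri (- k))%N by apply: tri_ge; rewrite abszN.
rewrite -(subnK Mt) -(subnK Mt') !exprD.
by rewrite mulrACA -exprMn uv0 mulr0.
Qed.

(** In the finite triple product multiplied by (w; w)_K, the terms of index at
    most M + 1 in absolute value have coefficient 1, and the others vanish. *)
Lemma jacobi_triple_product (M K : nat) u v (w := u * v) :
  w ^+ M = 0 -> (2 * M + 2 <= K)%N ->
  theta K u v = \prod_(i < K) (1 - w ^+ i.+1) *
    (\prod_(i < K) (1 + u * w ^+ i) * \prod_(i < K) (1 + v * w ^+ i)).
Proof.
move=> w0 MK; rewrite (finite_triple_product K K w0) -/(poch w K).
rewrite (poch_stationary w0); last by lia.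
rewrite /theta /box big_map -[iota _ _]/(index_iota 0 (2 * K).+1) big_mkord mul2n -addnn.
rewrite big_distrr; apply: eq_bigr => j _ /=.
have [far|near] := leqP M.+2 (absz (j%:Z - K%:Z)%R).
  by rewrite (theta_term0 w0 far) !mulr0.
by rewrite mulrA [poch w M * _]mulrC (qbinom_stationary w0) ?mul1r //; lia.
Qed.

(** * Products over residue classes *)
Section EulerProducts.
Variables (M : nat) (q : R) (q0 : q ^+ M = 0).

(** Since q^M = 0, the factors of index n >= M are 1. *)
Definition eprod (e : R) (c : pred nat) : R :=
  \prod_(1 <= n < M | c n) (1 + e * q ^+ n).

Lemma eprod_lreg e c : GRing.lreg (eprod e c).
Proof.
rewrite /eprod big_seq_cond; apply: lreg_prod => n /andP[].
rewrite mem_index_iota => /andP[n0 _] _.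
rewrite -[e * _]opprK; apply: (@lreg_sub1 M).
by rewrite -mulNr exprMn -exprM (expr_nil q0) ?mulr0 // leq_pmull.
Qed.

Lemma eprodU e (c c1 c2 : pred nat) :
  (forall n, c n = c1 n || c2 n) -> (forall n, ~~ (c1 n && c2 n)) ->
  eprod e c1 * eprod e c2 = eprod e c.
Proof.
move=> cE disj; rewrite /eprod [RHS](bigID c1) /=; congr (_ * _); apply: eq_bigl => n.
  by rewrite cE; case: (c1 n); rewrite ?orbT ?andbF.
by rewrite cE; have := disj n; case: (c1 n); case: (c2 n).
Qed.

Lemma eq_eprod e (c1 c2 : pred nat) : c1 =1 c2 -> eprod e c1 = eprod e c2.
Proof. exact: eq_bigl. Qed.

(** (1 + q^n) (1 - q^n) = 1 - q^(2n), and 2n runs over the class [c']. *)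
Lemma eprod_conj (c c' : pred nat) :
  (forall n, c' n = ~~ odd n && c n./2) -> eprod 1 c * eprod (-1) c = eprod (-1) c'.
Proof.
move=> c'E; rewrite /eprod -big_split /=.
rewrite (eq_bigr (fun n => 1 + -1 * q ^+ n.*2)); last first.
  by move=> n _; rewrite -addnn exprD; ring.
rewrite -big_filter -(big_map double xpredT (fun n => 1 + -1 * q ^+ n)) -[RHS]big_filter.
apply: eq_big_support.
- by rewrite (map_inj_uniq double_inj) filter_uniq ?iota_uniq.
- by rewrite filter_uniq ?iota_uniq.
move=> n; have [nM|Mn] := ltnP n M; last first.
  by right; rewrite (expr_nil q0 Mn) mulr0 addr0.
left; rewrite mem_filter mem_index_iota c'E; apply/mapP/idP.
  case=> k; rewrite mem_filter mem_index_iota => /and3P[ck k0 kM] nE.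
  by rewrite nE odd_double doubleK ck -nE nM; lia.
case/andP => /andP[on ch] nn; exists n./2; last by rewrite even_halfK.
by rewrite mem_filter mem_index_iota ch; lia.
Qed.

Lemma progression_eprod (K m a : nat) e : (M <= K)%N -> (0 < a <= m)%N ->
  \prod_(i < K) (1 + e * q ^+ (a + m * i)) = eprod e (fun n => n == a %[mod m]).
Proof.
move=> MK /andP[a0 am].
rewrite -(big_mkord xpredT (fun i => 1 + e * q ^+ (a + m * i))).
rewrite -(big_map (fun i => a + m * i)%N xpredT (fun n => 1 + e * q ^+ n)).
rewrite /eprod -[RHS]big_filter; apply: eq_big_support.
- by rewrite map_inj_uniq ?iota_uniq // => i j; nia.
- by rewrite filter_uniq ?iota_uniq.
move=> n; have [nM|Mn] := ltnP n M; last first.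
  by right; rewrite (expr_nil q0 Mn) mulr0 addr0.
left; rewrite mem_filter mem_index_iota; apply/mapP/idP.
  case=> i _ nE; have -> : n == a %[mod m] by rewrite nE addnC mulnC modnMDl.
  by rewrite nM nE /=; lia.
case/andP => na /andP[n0 _].
have an : (a <= n)%N.
  rewrite leqNgt; apply/negP => lt_na; move: na; rewrite modn_small; last by lia.
  have [-> | ?] := eqVneq a m; first by rewrite modnn; lia.
  by rewrite modn_small; lia.
move: na; rewrite (eqn_mod_dvd _ an) => /dvdnP[i ni].
by exists i; [rewrite mem_index_iota|]; nia.
Qed.

Lemma multiples_eprod (K m : nat) e : (M <= K)%N -> (0 < m)%N ->
  \prod_(i < K) (1 + e * q ^+ (m + m * i)) = eprod e (dvdn m).
Proof.
move=> MK m0; rewrite (@progression_eprod K m m) ?m0 ?leqnn //.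
by apply: eq_eprod => n; rewrite modnn.
Qed.

Lemma theta_eprod (K a b : nat) e :
  e ^+ 2 = 1 -> (0 < a)%N -> (0 < b)%N -> (2 * M + 2 <= K)%N ->
  theta K (e * q ^+ a) (e * q ^+ b) = eprod (-1) (dvdn (a + b)) *
    (eprod e (fun n => n == a %[mod a + b]) * eprod e (fun n => n == b %[mod a + b])).
Proof.
move=> e1 a0 b0 MK.
have uv : (e * q ^+ a) * (e * q ^+ b) = q ^+ (a + b) by rewrite exprD; ring: e1.
rewrite (@jacobi_triple_product M) ?uv; last 2 first.
- by rewrite -exprM (expr_nil q0) // leq_pmull // addn_gt0 a0.
- by [].
rewrite -(@multiples_eprod K) -?(@progression_eprod K); [|lia..].
congr (_ * (_ * _)); apply: eq_bigr => i _.
- by rewrite -exprM mulnS mulN1r.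
- by rewrite -exprM -mulrA -exprD.
- by rewrite -exprM -mulrA -exprD.
Qed.

(** The factor 2 is the term 1 + 1 of index 0 in the triple product for u = 1. *)
Lemma theta_eprod1 (K m : nat) :
  (0 < m)%N -> (2 * M + 2 <= K)%N ->
  theta K 1 (q ^+ m) = 2 * eprod (-1) (dvdn m) * eprod 1 (dvdn m) ^+ 2.
Proof.
move=> m0 MK.
rewrite (@jacobi_triple_product M) ?mul1r; last 2 first.
- by rewrite -exprM (expr_nil q0) // leq_pmull.
- by [].
have [L KL] : exists L, K = L.+1 by exists K.-1; lia.
have -> : \prod_(i < K) (1 - q ^+ m ^+ i.+1) = eprod (-1) (dvdn m).
  rewrite -(@multiples_eprod K); [|lia..].
  by apply: eq_bigr => i _; rewrite -exprM mulnS mulN1r.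
have -> : \prod_(i < K) (1 + q ^+ m * q ^+ m ^+ i) = eprod 1 (dvdn m).
  rewrite -(@multiples_eprod K); [|lia..].
  by apply: eq_bigr => i _; rewrite -exprM -exprD mul1r.
have -> : \prod_(i < K) (1 + 1 * q ^+ m ^+ i) = 2 * eprod 1 (dvdn m).
  rewrite KL big_ord_recl expr0 mulr1 -(@multiples_eprod L); [|lia..].
  congr (_ * _); apply: eq_bigr => i _.
  by rewrite -exprM -mulnS.
by ring.
Qed.

(** * The identity between the products *)
Definition mod3_6 (n : nat) : bool := n == 3 %[mod 6].

(** Put A, B for the products over the classes +-1 and +-2.  The elements +-2
    modulo 6 are the doubles of those +-1 and of those +-2, so that
    A(1) A(-1) * B(1) B(-1) = B(-1), and B(-1) can be cancelled. *)
Lemma euler_sign_pm : eprod 1 pm1_mod6 * eprod (-1) pm1_mod6 * eprod 1 pm2_mod6 = 1.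
Proof.
pose a2 (n : nat) := ((n %% 12 == 2) || (n %% 12 == 10))%N.
pose b2 (n : nat) := ((n %% 12 == 4) || (n %% 12 == 8))%N.
have eA : eprod 1 pm1_mod6 * eprod (-1) pm1_mod6 = eprod (-1) a2.
  by apply: eprod_conj => n; rewrite /a2 /pm1_mod6; lia.
have eB : eprod 1 pm2_mod6 * eprod (-1) pm2_mod6 = eprod (-1) b2.
  by apply: eprod_conj => n; rewrite /b2 /pm2_mod6; lia.
have eAB : eprod (-1) a2 * eprod (-1) b2 = eprod (-1) pm2_mod6.
  by apply: eprodU => n; rewrite /a2 /b2 /pm2_mod6; lia.
apply: (@eprod_lreg (-1) pm2_mod6).
by rewrite mulr1 -[RHS]eAB -eA -eB; ring.
Qed.

Lemma eprod12 : eprod (-1) (dvdn 12) = eprod 1 (dvdn 6) * eprod (-1) (dvdn 6).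
Proof. by symmetry; apply: eprod_conj => n; lia. Qed.

(** The multiples of 6 are those of 12 and the doubles of the numbers congruent to
    3 modulo 6; what remains after cancellation is the claim. *)
Lemma euler_mod3 : eprod 1 mod3_6 * eprod (-1) mod3_6 * eprod 1 (dvdn 6) = 1.
Proof.
pose c2 (n : nat) := (n %% 12 == 6)%N.
have eC : eprod 1 mod3_6 * eprod (-1) mod3_6 = eprod (-1) c2.
  by apply: eprod_conj => n; rewrite /c2 /mod3_6; lia.
have eE : eprod (-1) (dvdn 12) * eprod (-1) c2 = eprod (-1) (dvdn 6).
  by apply: eprodU => n; rewrite /c2; lia.
apply: (@eprod_lreg (-1) (dvdn 6)).
by rewrite mulr1 -[RHS]eE eprod12 -eC; ring.
Qed.

(** Multiplication by a power of E turns the products into theta series, on which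
    the splittings [sA], [sB], [sAC] and [sC] reduce everything to polynomials in
    P, Q, [al] and [be]; E is a regular element, so it can be cancelled. *)
Lemma product_identity :
  let A e := eprod e pm1_mod6 in let B e := eprod e pm2_mod6 in
  A 1 ^+ 4 * B 1 ^+ 8 - A (-1) ^+ 4 * B (-1) ^+ 8 -
    q * (A 1 ^+ 8 * B 1 ^+ 4 - A (-1) ^+ 8 * B (-1) ^+ 4) = 8 * q.
Proof.
move=> A B.
pose C e := eprod e mod3_6.
pose E := eprod (-1) (dvdn 6); pose F := eprod (-1) (dvdn 12).
pose z := eprod 1 (dvdn 6).
pose K := (2 * M + 2)%N.
have KM : (2 * M + 2 <= K)%N by [].
pose P := theta K (q ^+ 4) (q ^+ 8); pose Q := theta K (q ^+ 2) (q ^+ 10).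
pose al := theta K (q ^+ 6) (q ^+ 6); pose be := theta K 1 (q ^+ 12).
have tA e : e ^+ 2 = 1 -> theta K (e * q) (e * q ^+ 5) = E * A e.
  move=> e1; rewrite -{1}(expr1 q) (theta_eprod e1) //; congr (_ * _).
  by apply: eprodU => n; rewrite /pm1_mod6; lia.
have tB e : e ^+ 2 = 1 -> theta K (e * q ^+ 2) (e * q ^+ 4) = E * B e.
  move=> e1; rewrite (theta_eprod e1) //; congr (_ * _).
  by apply: eprodU => n; rewrite /pm2_mod6; lia.
have tC e : e ^+ 2 = 1 -> theta K (e * q ^+ 3) (e * q ^+ 3) = E * C e ^+ 2.
  by move=> e1; rewrite (theta_eprod e1) // expr2.
have PQ : P * Q = F ^+ 2 * B 1.
  rewrite /P /Q -(mul1r (q ^+ 4)) -(mul1r (q ^+ 8)) -(mul1r (q ^+ 2)) -(mul1r (q ^+ 10)).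
  rewrite !theta_eprod ?expr1n //.
  pose b2 (n : nat) := ((n %% 12 == 2) || (n %% 12 == 10))%N.
  pose b4 (n : nat) := ((n %% 12 == 4) || (n %% 12 == 8))%N.
  rewrite (@eprodU _ b4) ?(@eprodU _ b2); try by move=> n; rewrite /b2 /b4; lia.
  rewrite mulrACA -expr2 (@eprodU _ pm2_mod6) // => n; rewrite /b2 /b4 /pm2_mod6; lia.
have albe : al * be = 2 * F ^+ 2 * z ^+ 2.
  rewrite /al /be -(mul1r (q ^+ 6)) theta_eprod ?expr1n // theta_eprod1 //.
  rewrite /z -(@eprodU 1 (dvdn 6) (fun n => n == 6 %[mod 6 + 6]) (dvdn 12)).
  - by rewrite -[(6 + 6)%N]/12%N -/F; ring.
  - by move=> n; lia.
  - by move=> n; lia.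
have nilp e n : (0 < n)%N -> (e * q ^+ n) ^+ M = 0.
  by move=> n0; rewrite exprMn -exprM (expr_nil q0) ?mulr0 // leq_pmull.
have K2 : (M.+2 <= K)%N by rewrite /K; lia.
(* Stating the arguments of [theta_mul] by equations lets [ring], with e^2 = 1,
   identify them as powers of q. *)
have theta_split e n x y b c d m1 m2 m3 m4 n1 n2 (a := e * q ^+ n) : (0 < n)%N ->
    b = a * x * y -> c = a * y -> d = a * x ->
    m1 = a * a * y -> m2 = m1 * x * x -> m3 = a * a * x -> m4 = m3 * y * y ->
    n1 = a * a * a * a * x * y * y -> n2 = a * a * a * a * x * x * y ->
    theta K a b * theta K c d = theta K m1 m2 * theta K m3 m4 + a * (theta K x n1 * theta K y n2).
  move=> n0 -> -> -> -> -> -> -> -> ->; rewrite (theta_mul x y (nilp e n n0 : a ^+ M = 0) K2).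
  by congr (theta K _ _ * theta K _ _ + _); ring.
have sA e : e ^+ 2 = 1 -> E ^+ 2 * A e ^+ 2 = Q * al + e * q * (P * be).
  move=> e1; rewrite -exprMn -tA // expr2 -{1 3}[e * q]/(e * q ^+ 1).
  rewrite (theta_split e 1%N (q ^+ 4) 1 _ _ _ (q ^+ 2) (q ^+ 10) (q ^+ 6) (q ^+ 6) (q ^+ 8) (q ^+ 12)) //;
    by ring: e1.
have sB e : e ^+ 2 = 1 -> E ^+ 2 * B e ^+ 2 = P * al + e * q ^+ 2 * (Q * be).
  move=> e1; rewrite -exprMn -tB // expr2.
  by rewrite (theta_split e 2%N (q ^+ 2) 1 _ _ _ (q ^+ 4) (q ^+ 8) (q ^+ 6) (q ^+ 6) (q ^+ 10) (q ^+ 12)) //;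
    ring: e1.
have sAC e : e ^+ 2 = 1 -> E ^+ 2 * (A e * C e ^+ 2) = P ^+ 2 + e * q * Q ^+ 2.
  move=> e1; rewrite [LHS](_ : _ = (E * A e) * (E * C e ^+ 2)); last by ring.
  rewrite -tA // -tC // -{1}[e * q]/(e * q ^+ 1).
  by rewrite (theta_split e 1%N (q ^+ 2) (q ^+ 2) _ _ _ (q ^+ 4) (q ^+ 8) (q ^+ 4) (q ^+ 8) (q ^+ 10) (q ^+ 10)) //;
    ring: e1.
have sC e : e ^+ 2 = 1 -> E ^+ 2 * C e ^+ 4 = al ^+ 2 + e * q ^+ 3 * be ^+ 2.
  move=> e1; rewrite [LHS](_ : _ = (E * C e ^+ 2) * (E * C e ^+ 2)); last by ring.
  rewrite -tC //.
  by rewrite (theta_split e 3%N 1 1 _ _ _ (q ^+ 6) (q ^+ 6) (q ^+ 6) (q ^+ 6) (q ^+ 12) (q ^+ 12)) //;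
    ring: e1.
have regE (n : nat) : GRing.lreg (E ^+ n) by apply: lregX; exact: eprod_lreg.
have s1 : (1 : R) ^+ 2 = 1 by rewrite expr1n.
have sN1 : (-1 : R) ^+ 2 = 1 by rewrite sqrrN expr1n.
(* In [sA] and [sB], the cross terms of the two squares cancel. *)
have common e : e ^+ 2 = 1 -> B e ^+ 4 - q * A e ^+ 4 = A (-1) * C (-1) ^+ 6.
  move=> e1; apply: (regE 4%N).
  transitivity ((E ^+ 2 * B e ^+ 2) ^+ 2 - q * (E ^+ 2 * A e ^+ 2) ^+ 2); first by ring.
  rewrite sA // sB //.
  transitivity ((P ^+ 2 + -1 * q * Q ^+ 2) * (al ^+ 2 + -1 * q ^+ 3 * be ^+ 2)).
    by ring: e1.
  by rewrite -sAC // -sC //; ring.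
(* Of (X + Y)^2 - (X - Y)^2 only 4 X Y remains: X has the factor P Q, and Y the
   factor q [al] [be]. *)
have diff : (A 1 * B 1) ^+ 4 - (A (-1) * B (-1)) ^+ 4 = 8 * q * z ^+ 6 * A 1 * B 1 * C 1 ^+ 6.
  apply: (regE 8%N).
  transitivity (((E ^+ 2 * A 1 ^+ 2) * (E ^+ 2 * B 1 ^+ 2)) ^+ 2 -
     ((E ^+ 2 * A (-1) ^+ 2) * (E ^+ 2 * B (-1) ^+ 2)) ^+ 2); first by ring.
  rewrite !sA // !sB //.
  transitivity (4 * q * (P * Q) * (al * be) * (P ^+ 2 + 1 * q * Q ^+ 2) *
      (al ^+ 2 + 1 * q ^+ 3 * be ^+ 2)); first by ring.
  rewrite -sAC // -sC // PQ albe /F eprod12 -/z -/E; ring.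
have eAB : A 1 * A (-1) * B 1 = 1 by exact: euler_sign_pm.
have eC : C 1 * C (-1) * z = 1 by exact: euler_mod3.
transitivity ((A 1 * B 1) ^+ 4 * (B 1 ^+ 4 - q * A 1 ^+ 4) -
  (A (-1) * B (-1)) ^+ 4 * (B (-1) ^+ 4 - q * A (-1) ^+ 4)); first by ring.
rewrite !common // -mulrBl diff.
transitivity (8 * q * (A 1 * A (-1) * B 1) * (C 1 * C (-1) * z) ^+ 6); first by ring.
by rewrite eAB eC expr1n !mulr1.
Qed.
End EulerProducts.
End Theta.

Local Open Scope fset_scope.
Local Open Scope ring_scope.

(** * Counting partitions by signed generating functions *)
Lemma prod_fset_add1 (R : comNzRingType) (T : choiceType) (A : {fset T}) (F : T -> R) :
  \prod_(x <- A) (1 + F x) = \sum_(B <- fpowerset A) \prod_(x <- B) F x.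
Proof.
elim/fset1U_rect: A => [|x A xA IH].
  by rewrite big_seq_fset0 fpowerset0 big_seq_fset1 big_seq_fset0.
have notin B : B \in fpowerset A -> x \notin B.
  by rewrite fpowersetE => /fsubsetP sBA; apply: contra xA; exact: sBA.
have pE : perm_eq (fpowerset (x |` A))
    (fpowerset A ++ [seq x |` B | B <- fpowerset A]).
  apply: uniq_perm; first exact: fset_uniq.
    rewrite cat_uniq fset_uniq /=; apply/andP; split.
      apply/hasPn => _ /mapP[B _ ->]; apply/negP => /notin.
      by rewrite fset1U1.
    rewrite map_inj_in_uniq ?fset_uniq // => B C /notin xB /notin xC e.
    by rewrite -(fsetU1K xB) -(fsetU1K xC) e.
  move=> B; rewrite mem_cat !fpowersetE; apply/idP/orP.
    move=> sB; have [xB|xB] := boolP (x \in B); last first.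
      by left; rewrite -(fsetU1K xA) fsubsetD1 sB xB.
    right; apply/mapP; exists (B `\ x); last by rewrite fsetD1K.
    by rewrite fpowersetE fsubDset.
  case=> [sB|/mapP[C]]; first by apply: fsubset_trans sB (fsubsetU1 _ _).
  by rewrite fpowersetE => sC ->; exact: fsetUS.
rewrite big_fsetU1 //= IH (perm_big _ pE) big_cat big_map mulrDl mul1r /=.
congr (_ + _); rewrite big_distrr !big_seq; apply: eq_bigr => B /notin xB.
by rewrite big_fsetU1.
Qed.

(** A subset of [copies_le k N] with sum m and cardinality c contributes
    e^c to the coefficient of degree m. *)
Definition signed_gf (k : nat -> nat) (N : nat) (e : int) : {poly int} :=
  \prod_(x <- copies_le k N) (1 + e%:P * 'X^(x.1)).

(** Elements larger than m cannot be used, so any bound N >= m may replace the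
    one of the definition; all degrees then share one generating function. *)
Lemma odd_partitions_bound k N m : (m <= N)%N ->
  odd_partitions k m = [fset A in fpowerset (copies_le k N)
     | (\sum_(x <- A) x.1 == m)%N && odd #|` A|].
Proof.
move=> mN; apply/fsetP => A; apply/odd_partitionsP/idP.
  case=> -[sA sumA] oddA; rewrite !inE /= fpowersetE oddA sumA eqxx !andbT.
  apply/fsubsetP => x xA; rewrite mem_copies_le sA //=.
  by apply: leq_trans mN; rewrite -sumA (big_rem x) //= leq_addr.
rewrite !inE /= fpowersetE => /and3P[/fsubsetP sA /eqP sumA oddA].
by do 2!split=> //; move=> x /sA; rewrite mem_copies_le => /andP[].
Qed.

Definition odd_gf (k : nat -> nat) (N : nat) : {poly int} :=
  signed_gf k N 1 - signed_gf k N (-1).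

Lemma coef_odd_gf k N m : (m <= N)%N ->
  (odd_gf k N)`_m = (D k m)%:Z * 2.
Proof.
move=> mN.
have expand e : signed_gf k N e =
    \sum_(A <- fpowerset (copies_le k N)) (e ^+ #|` A|)%:P * 'X^(\sum_(x <- A) x.1).
  rewrite /signed_gf prod_fset_add1; apply: eq_bigr => A _.
  by rewrite big_split /= card_fset_sum1 rmorphXn /= !expr_sum.
rewrite /odd_gf !expand -sumrB coef_sum /D (odd_partitions_bound k mN) card_fset_sum1.
rewrite -big_fset_condE -natz natr_sum big_distrl [in RHS]big_mkcond /=.
apply: eq_bigr => A _; rewrite expr1n -signr_odd coefB !coefCM coefXn eq_sym.
by case: (_ == m); case: (odd _).
Qed.

Lemma signed_gfE k N e :
  signed_gf k N e = \prod_(1 <= n < N.+1) (1 + e%:P * 'X^n) ^+ k n.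
Proof.
have uniq_copies : uniq [seq (n, c) | n <- iota 1 N, c <- iota 0 (k n)].
  apply: allpairs_uniq_dep => [|n _|]; rewrite ?iota_uniq //.
  by move=> [n c] [n' c'] _ _ /= [-> ->].
rewrite /signed_gf /copies_le (perm_big [seq (n, c) | n <- iota 1 N, c <- iota 0 (k n)]).
  rewrite big_allpairs_dep /index_iota subn1 /=; apply: eq_bigr => n _.
  by rewrite big_const_seq count_predT size_iota iter_mulr_1.
by apply: uniq_perm; rewrite ?fset_uniq // => x; rewrite !inE.
Qed.

(** Reduction modulo X^(n+1) keeps the coefficients of degree at most n. *)
Lemma in_qpoly_coef (R : nzRingType) (n m : nat) (p : {poly R}) :
  (m <= n)%N -> in_qpoly 'X^(n.+1) p = 0 -> p`_m = 0.
Proof.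
move=> mn /(congr1 val) /= p0.
have := Pdiv.RingMonic.rdivp_eq (monic_mk_monic 'X^(n.+1)) p.
by rewrite p0 addr0 mk_monic_Xn => ->; rewrite coefMXn ltnS mn.
Qed.

Lemma eprod_in_qpoly N (e : int) (c : pred nat) :
  in_qpoly 'X^(N.+1) (\prod_(1 <= n < N.+1 | c n) (1 + e%:P * 'X^n)) =
  eprod N.+1 (in_qpoly 'X^(N.+1) 'X) e%:~R c.
Proof.
rewrite rmorph_prod; apply: eq_bigr => n _.
have -> : e%:P = e%:~R :> {poly int} by rewrite -[e in LHS]intz rmorph_int.
by rewrite rmorphD rmorph1 rmorphM rmorphXn rmorph_int.
Qed.

Lemma prod_copies (R : comNzRingType) (k : nat -> nat) (N i j : nat) (G : nat -> R) :
  (forall n, k n = if pm1_mod6 n then i else if pm2_mod6 n then j else 0) ->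
  \prod_(1 <= n < N) G n ^+ k n =
    (\prod_(1 <= n < N | pm1_mod6 n) G n) ^+ i * (\prod_(1 <= n < N | pm2_mod6 n) G n) ^+ j.
Proof.
move=> kE; rewrite -!prodrXl [in RHS]big_mkcond [X in _ * X]big_mkcond -big_split /=.
apply: eq_bigr => n _; rewrite kE.
have : ~~ (pm1_mod6 n && pm2_mod6 n) by rewrite /pm1_mod6 /pm2_mod6; lia.
by case: (pm1_mod6 n); case: (pm2_mod6 n); rewrite ?mulr1 ?mul1r.
Qed.

(** [product_identity] in the integer polynomials modulo X^(N+1), with q = X. *)
Lemma odd_gf_identity (N m : nat) : (m <= N)%N ->
  (odd_gf S_copies N - 'X * odd_gf T_copies N - 8%:P * 'X)`_m = 0.
Proof.
move=> mN; apply: (in_qpoly_coef mN).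
pose h := in_qpoly ('X^(N.+1) : {poly int}); pose q := h 'X.
have q0 : q ^+ N.+1 = 0.
  apply/val_inj; rewrite /= -rmorphXn /= mk_monic_Xn.
  by rewrite Pdiv.RingMonic.rmodpp // monicXn.
have S_gf e : signed_gf S_copies N e =
    (\prod_(1 <= n < N.+1 | pm1_mod6 n) (1 + e%:P * 'X^n)) ^+ 4 *
    (\prod_(1 <= n < N.+1 | pm2_mod6 n) (1 + e%:P * 'X^n)) ^+ 8.
  by rewrite signed_gfE; exact: prod_copies.
have T_gf e : signed_gf T_copies N e =
    (\prod_(1 <= n < N.+1 | pm1_mod6 n) (1 + e%:P * 'X^n)) ^+ 8 *
    (\prod_(1 <= n < N.+1 | pm2_mod6 n) (1 + e%:P * 'X^n)) ^+ 4.
  by rewrite signed_gfE; exact: prod_copies.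
rewrite polyC_natr /odd_gf !S_gf !T_gf !(rmorphB, rmorphM, rmorphXn) /=.
rewrite !eprod_in_qpoly mulrN1z mulr1z -/h -/q.
by rewrite (product_identity q0) /h rmorph_nat subrr.
Qed.

Local Close Scope ring_scope.
Local Close Scope fset_scope.

Theorem theorem3p19 (N : nat) (hN : 2 <= N) :
  D S_copies N = D T_copies (N - 1).
Proof.
have := odd_gf_identity (leqnn N).
have [N0 N1] : N != 0 /\ N != 1 by lia.
rewrite coefB coefCM coefX (negPf N1) coefB coefXM (negPf N0).
rewrite !coef_odd_gf ?leqnn ?leq_pred // subn1; lia.
Qed.
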